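(* Let $n\geq 2$ and let $\mathcal{G}=\{G_1, G_2, \ldots , G_{2n}\}$ be a family of (not necessarily distinct) balanced bipartite graphs on the common vertex set $[2n]$ with the common bipartition $(X, Y)$. If $$\rho (G_i) \geq \rho(K_{1, n-1}\sqcup \widehat{K_{n-1, 1}})$$ for every $i\in [2n]$, then $\mathcal{G}$ admits a rainbow Hamilton cycle unless $G_1=G_2=\cdots =G_{2n}\cong K_{1, n-1}\sqcup \widehat{K_{n-1, 1}}$.
   Context: All graphs are simple and undirected. $[k]=\{1,2,\ldots,k\}$. A bipartite graph with bipartition $(X,Y)$ is balanced if $|X|=|Y|$. $\rho(G)$ is the spectral radius of $G$, i.e. the maximum modulus of the eigenvalues of its adjacency matrix. $K_{s,t}$ is the complete bipartite graph with first part of size $s$ and second part of size $t$. For a bipartite graph $G$ with bipartition $(X,Y)$, its quasi-complement $\widehat{G}$ has the same vertex set and bipartition, and for $x\in X,y\in Y$, $xy\in E(\widehat G)$ iff $xy\notin E(G)$. For bipartite graphs $G_1,G_2$ with bipartitions $(X_1,Y_1)$, $(X_2,Y_2)$, $G_1\sqcup G_2$ is the bipartite graph obtained from the disjoint union $G_1\cup G_2$ by adding all edges between $X_1$ and $Y_2$ and all edges between $Y_1$ and $X_2$. (So $K_{1, n-1}\sqcup \widehat{K_{n-1, 1}}$ is $K_{n,n}$ with $n-1$ of the $n$ edges at one fixed vertex removed.) $G_i=G_j$ means equality as graphs on the labelled vertex set (same edge set), while $\cong$ denotes isomorphism. For a family $\mathcal{G}=\{G_1,\ldots,G_k\}$ of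 not necessarily distinct graphs on the same vertex set $V$ and a graph $H$ with $k$ edges and $V(H)\subseteq V$, $H$ is a rainbow copy in $\mathcal{G}$ if there is a bijection $\phi:E(H)\to[k]$ with $e\in E(G_{\phi(e)})$ for all $e\in E(H)$. A rainbow Hamilton cycle in $\mathcal{G}$ is such an $H$ that is a cycle visiting every vertex of $V$ exactly once. *)

(* Defs.v *)
From HB Require Import structures.
From mathcomp Require Import all_boot all_order all_algebra all_field.

Set Implicit Arguments.
Unset Strict Implicit.
Unset Printing Implicit Defensive.

Import Order.TTheory GRing.Theory Num.Theory.

Local Open Scope ring_scope.

Record sgraph (V : finType) := SGraph {
  adj : rel V;
  adj_sym : symmetric adj;
  adj_irrefl : irreflexive adj }.

Definition edges (V : finType) (G : sgraph V) : {set {set V}} :=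
  [set [set p.1; p.2] | p : V * V & adj G p.1 p.2].

Definition same_graph (V : finType) (G H : sgraph V) : Prop := adj G =2 adj H.

Definition isomorphic (V W : finType) (G : sgraph V) (H : sgraph W) : Prop :=
  exists2 f : V -> W, bijective f & forall u v, adj G u v = adj H (f u) (f v).

(* Eigenvalues listed with multiplicity.  The matrices considered here have
   integer entries, so all their complex eigenvalues are in algC. *)
Definition eigenvalues m (A : 'M[algC]_m) : seq algC :=
  sval (closed_field_poly_normal (char_poly A)).

Lemma mem_eigenvalues m (A : 'M[algC]_m) z :
  (z \in eigenvalues A) = eigenvalue A z.
Proof.
rewrite eigenvalue_root_char /eigenvalues.
case: closed_field_poly_normal => r /= {1}->.
by rewrite (monicP (char_poly_monic A)) scale1r root_prod_XsubC.
Qed.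

(* algC is only partially ordered, but the moduli are real, hence pairwise
   comparable. *)
Definition spectral_radius m (A : 'M[algC]_m) : algC :=
  \big[Num.max/0]_(z <- eigenvalues A) `|z|.

Definition adjacency (V : finType) (G : sgraph V) : 'M[algC]_#|V| :=
  \matrix_(i, j) (adj G (enum_val i) (enum_val j))%:R.

Definition rho (V : finType) (G : sgraph V) : algC :=
  spectral_radius (adjacency G).

Definition across (V : finType) (X Y : {set V}) : rel V :=
  fun u v => (u \in X) && (v \in Y) || (u \in Y) && (v \in X).

Definition is_bipartition (V : finType) (G : sgraph V) (X Y : {set V}) : Prop :=
  [/\ [disjoint X & Y], X :|: Y = [set: V] &
      forall u v, adj G u v -> across X Y u v].

Record bigraph (V : finType) := BiGraph {
  graph_of :> sgraph V;
  lpart : {set V};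
  rpart : {set V};
  bigraphP : is_bipartition graph_of lpart rpart }.

Definition balanced (V : finType) (G : bigraph V) : Prop :=
  #|lpart G| = #|rpart G|.

Lemma across_sym (V : finType) (X Y : {set V}) : symmetric (across X Y).
Proof. by move=> u v; rewrite /across orbC ![(v \in _) && _]andbC. Qed.

Lemma across_irrefl (V : finType) (X Y : {set V}) :
  [disjoint X & Y] -> irreflexive (across X Y).
Proof.
move=> dXY u; rewrite /across [(u \in Y) && _]andbC orbb.
by apply/negP => /andP[uX]; rewrite (disjointFr dXY uX).
Qed.

Section CompleteBipartite.

Variables s t : nat.

Let X : {set 'I_s + 'I_t} := [set inl i | i : 'I_s].
Let Y : {set 'I_s + 'I_t} := [set inr j | j : 'I_t].

Let dXY : [disjoint X & Y].
Proof.
by apply/pred0P => u /=; apply/negP => /andP[/imsetP[i _ ->] /imsetP[j _]].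
Qed.

Definition complete_sgraph : sgraph ('I_s + 'I_t)%type :=
  SGraph (across_sym X Y) (across_irrefl dXY).

Let bipP : is_bipartition complete_sgraph X Y.
Proof.
split=> //; apply/setP => -[i|j]; rewrite !in_setU in_setT.
  by rewrite (imset_f inl).
by rewrite (imset_f inr) ?orbT.
Qed.

Definition complete_bipartite : bigraph ('I_s + 'I_t)%type := BiGraph bipP.

End CompleteBipartite.

Section QuasiComplement.

Variables (V : finType) (G : bigraph V).

Let e : rel V := fun u v => across (lpart G) (rpart G) u v && ~~ adj G u v.

Let e_sym : symmetric e.
Proof. by move=> u v; rewrite /e across_sym adj_sym. Qed.

Let e_irrefl : irreflexive e.
Proof. by move=> u; rewrite /e across_irrefl //; case: (bigraphP G). Qed.

Definition quasi_complement_sgraph : sgraph V := SGraph e_sym e_irrefl.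

Let bipP : is_bipartition quasi_complement_sgraph (lpart G) (rpart G).
Proof. by case: (bigraphP G) => d c _; split=> // u v /andP[]. Qed.

Definition quasi_complement : bigraph V := BiGraph bipP.

End QuasiComplement.

Lemma inl_inj (A B : Type) : injective (@inl A B).
Proof. by move=> ? ? []. Qed.

Lemma inr_inj (A B : Type) : injective (@inr A B).
Proof. by move=> ? ? []. Qed.

Section Sqcup.

Variables (V1 V2 : finType) (G1 : bigraph V1) (G2 : bigraph V2).

Let e : rel (V1 + V2)%type := fun u v =>
  match u, v with
  | inl u1, inl v1 => adj G1 u1 v1
  | inr u2, inr v2 => adj G2 u2 v2
  | inl w1, inr w2 | inr w2, inl w1 =>
      (w1 \in lpart G1) && (w2 \in rpart G2)
      || (w1 \in rpart G1) && (w2 \in lpart G2)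
  end.

Let e_sym : symmetric e.
Proof. by move=> [u|u] [v|v] //=; rewrite adj_sym. Qed.

Let e_irrefl : irreflexive e.
Proof. by move=> [u|u] /=; rewrite adj_irrefl. Qed.

Definition sqcup_sgraph : sgraph (V1 + V2)%type := SGraph e_sym e_irrefl.

Let X : {set V1 + V2} := inl @: lpart G1 :|: inr @: lpart G2.
Let Y : {set V1 + V2} := inl @: rpart G1 :|: inr @: rpart G2.

Let in_inl (A : {set V1}) (B : {set V2}) u :
  (inl u \in inl @: A :|: inr @: B) = (u \in A).
Proof.
rewrite in_setU (mem_imset _ _ (@inl_inj V1 V2)).
by have [/imsetP[]|_] := boolP (inl u \in inr @: B); rewrite ?orbF.
Qed.

Let in_inr (A : {set V1}) (B : {set V2}) u :
  (inr u \in inl @: A :|: inr @: B) = (u \in B).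
Proof.
rewrite in_setU (mem_imset _ _ (@inr_inj V1 V2)).
by have [/imsetP[]|_] := boolP (inr u \in inl @: A).
Qed.

Let bipP : is_bipartition sqcup_sgraph X Y.
Proof.
case: (bigraphP G1) (bigraphP G2) => d1 c1 b1 [d2 c2 b2]; split.
- apply/pred0P => -[u|u] /=; rewrite /X /Y ?in_inl ?in_inr.
    by apply/negP => /andP[uX]; rewrite (disjointFr d1 uX).
  by apply/negP => /andP[uX]; rewrite (disjointFr d2 uX).
- apply/setP => -[u|u]; rewrite in_setU /X /Y ?in_inl ?in_inr -in_setU ?c1 ?c2.
    by rewrite !inE.
  by rewrite !inE.
- move=> [u|u] [v|v]; rewrite /across /X /Y ?in_inl ?in_inr /=.
  + exact: b1.
  + by [].
  + by rewrite orbC ![(v \in _) && _]andbC.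
  + exact: b2.
Qed.

Definition sqcup : bigraph (V1 + V2)%type := BiGraph bipP.

End Sqcup.

Definition extremal n :=
  sqcup (complete_bipartite 1 n.-1)
        (quasi_complement (complete_bipartite n.-1 1)).

(* A subgraph H with V(H) contained in V is given as a graph on V; only its
   edges matter here. *)
Definition rainbow (V : finType) (k : nat) (G : 'I_k -> sgraph V)
    (H : sgraph V) : Prop :=
  exists phi : {set V} -> 'I_k,
    [/\ {in edges H &, injective phi},
        phi @: edges H = [set: 'I_k] &
        forall e, e \in edges H -> e \in edges (G (phi e))].

Definition hamilton_cycle (V : finType) (H : sgraph V) : Prop :=
  exists s : seq V,
    [/\ (2 < size s)%N, uniq s, forall v, v \in s &
        forall u v, adj H u v = (next s u == v) || (next s v == u)].

Definition has_rainbow_hamilton_cycle (V : finType) (k : nat)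
    (G : 'I_k -> sgraph V) : Prop :=
  exists2 H : sgraph V, hamilton_cycle H & rainbow G H.

(* Main.v *)
(* Cauchy-Schwarz applied to an eigenvector gives rho(G)^2 <= e(G) for bipartite G,
   while rho(extremal n)^2 > n(n-1); hence every G_i misses at most n-1 of the
   n^2 pairs of X * Y.  Let w(p) be the number of colours missing the pair p,
   so that the sum of w is at most 2n(n-1), and call p dead if w(p) = 2n.

   If at most n-2 pairs are dead, let T consist of n-2 pairs of largest weight.
   Some Hamilton cycle C of K_{n,n} avoids T, and every such C is rainbow: a set
   of t edges of C violating Hall's condition against the colours is missed in
   common by at least 2n-t+1 colours (so t <= n-1), whence the n-2+t pairs formed
   by these edges and T all have weight at least 2n-t+1.  Then
   (n-2+t)(2n-t+1) <= 2n(n-1), which forces t = 1, and then n-1 pairs are dead.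

   If n-1 pairs are dead, all G_i are equal, and a balanced bipartite graph
   missing at most n-1 pairs is Hamiltonian unless these form a star. *)
Require Import Defs.
From HB Require Import structures.
From mathcomp Require Import all_boot all_order all_algebra all_field.
From mathcomp Require Import zify ring.

Set Implicit Arguments.
Unset Strict Implicit.
Unset Printing Implicit Defensive.

Import Order.TTheory GRing.Theory Num.Theory.

(** * Hall's marriage theorem *)

(* Rado's argument: if [A i] contains two elements, submodularity of the size of
   unions shows that one of them can be removed without breaking Hall's
   condition; so all the sets can be shrunk to singletons. *)
Lemma hall_marriage (I T : finType) (A : I -> {set T}) :
  (forall J : {set I}, #|J| <= #|\bigcup_(i in J) A i|) ->
  exists2 f : I -> T, injective f & forall i, f i \in A i.
Proof.
have [n] := ubnP (\sum_i #|A i|); elim: n A => // n IHn A leAn hallA.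
have [i /= /card_gt1P[x [y [xA yA neq_xy]]] | small] :=
  pickP [pred i | 1 < #|A i|]; last first.
  have [f Af]: exists f : I -> T, forall i, A i = [set f i].
    apply: (fin_all_exists (P := fun i t => A i = [set t])) => i.
    have := hallA [set i]; rewrite big_set1 cards1 => Ai_gt0.
    have /cards1P[t ->]: #|A i| == 1 by have /= := small i; lia.
    by exists t.
  exists f => [i j eq_f | i]; last by rewrite Af set11.
  apply/eqP/negPn/negP => neq_ij; have := hallA [set i; j].
  by rewrite cards2 neq_ij bigcup_setU !big_set1 !Af eq_f setUid cards1.
pose B z j := if j == i then A i :\ z else A j.
have B_sub z j : B z j \subset A j.
  by rewrite /B; case: eqP => [->|//]; rewrite subD1set.
have [hallB | ] := boolP [exists z in A i,
    [forall J : {set I}, #|J| <= #|\bigcup_(j in J) B z j|]].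
  case/exists_inP: hallB => z zA /forallP hallB.
  have [|f injf fB] := IHn (B z) _ hallB.
    rewrite -ltnS; apply: leq_trans leAn; rewrite ltnS (bigD1 i) //= [ltnRHS](bigD1 i) //=.
    rewrite -addSn leq_add //; first by rewrite /B eqxx [ltnRHS](cardsD1 z) zA.
    by apply: leq_sum => j _; apply: subset_leq_card.
  by exists f => // j; apply: (subsetP (B_sub z j)).
rewrite negb_exists_in => /forall_inP noB.
have bad z : z \in A i -> exists2 J : {set I}, i \in J &
    #|\bigcup_(j in J) B z j| < #|J|.
  move/noB; rewrite negb_forall => /existsP[J]; rewrite -ltnNge => ltJ.
  exists J => //; apply: contraLR ltJ => iJ; rewrite -leqNgt.
  rewrite (eq_bigr A) ?hallA // => j jJ; rewrite /B.
  by case: eqP iJ => // <-; rewrite jJ.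
have [[J1 iJ1 lt1] [J2 iJ2 lt2]] := (bad x xA, bad y yA).
set U1 := \bigcup_(_ in _) _ in lt1; set U2 := \bigcup_(_ in _) _ in lt2.
(* As [x] and [y] differ, each element of [A i] survives one of the two removals, so [U1 :|: U2]
   covers the sets indexed by [J1 :|: J2]; the intersection need only cover those other than [A i].
   Hall's condition then gives [#|U1| + #|U2| >= #|J1| + #|J2| - 1], against [lt1] and [lt2]. *)
have subU : \bigcup_(j in J1 :|: J2) A j \subset U1 :|: U2.
  apply/bigcupsP => j jJ; apply/subsetP => t tA.
  have [eq_ji | neq_ji] := eqVneq j i.
    rewrite eq_ji in tA; rewrite in_setU; apply/orP.
    have [eq_t | neq_t] := eqVneq t x.
      right; apply/bigcupP; exists i => //.
      by rewrite /B eqxx in_setD1 tA eq_t neq_xy.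
    by left; apply/bigcupP; exists i => //; rewrite /B eqxx in_setD1 tA neq_t.
  rewrite in_setU; move: jJ; rewrite in_setU => /orP[jJ|jJ]; apply/orP.
    by left; apply/bigcupP; exists j => //; rewrite /B (negPf neq_ji).
  by right; apply/bigcupP; exists j => //; rewrite /B (negPf neq_ji).
have subI : \bigcup_(j in (J1 :&: J2) :\ i) A j \subset U1 :&: U2.
  apply/bigcupsP => j; rewrite in_setD1 in_setI => /and3P[neq_ji j1 j2].
  apply/subsetP => t tA; rewrite in_setI; apply/andP.
  by split; apply/bigcupP; exists j => //; rewrite /B (negPf neq_ji).
have := leq_trans (hallA _) (subset_leq_card subU).
have := leq_trans (hallA _) (subset_leq_card subI).
have := cardsUI U1 U2; have := cardsUI J1 J2.
have := cardsD1 i (J1 :&: J2); rewrite in_setI iJ1 iJ2.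
lia.
Qed.

(** * Hamilton cycles of a bipartite graph missing few pairs *)

(** Ordering each pair from [A] to [B] counts it once. For the negated relation these pairs are the
    edges, which is how edges are counted below. *)
Definition nonadj (V : finType) (e : rel V) (A B : {set V}) : {set V * V} :=
  [set p in setX A B | ~~ e p.1 p.2].

Definition codeg (V : finType) (e : rel V) (B : {set V}) (a : V) : nat :=
  #|[set b in B | ~~ e a b]|.

(** The relation [e] may hold inside a side, so crossing between the sides is demanded
    separately. *)
Definition has_alternating_cycle (V : finType) (e : rel V) (A B : {set V}) :=
  exists s : seq V, [/\ uniq s, s =i A :|: B &
    cycle [rel u v | e u v && across A B u v] s].

Section AlternatingCycle.

Variables (V : finType) (e : rel V).
Hypothesis e_sym : symmetric e.
Implicit Types A B : {set V}.

Lemma mem_nonadj A B a b :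
  ((a, b) \in nonadj e A B) = [&& a \in A, b \in B & ~~ e a b].
Proof. by rewrite !inE andbA. Qed.

Lemma codeg_le_nonadj A B a : a \in A -> codeg e B a <= #|nonadj e A B|.
Proof.
have pair_inj : injective (@pair V V a) by move=> ? ? [].
move=> aA; rewrite /codeg -(card_imset _ pair_inj).
apply/subset_leq_card/subsetP => _ /imsetP[b + ->].
by rewrite inE mem_nonadj aA.
Qed.

Lemma nonadj_swap A B : #|nonadj e B A| = #|nonadj e A B|.
Proof.
have swap_inj : injective (fun p : V * V => (p.2, p.1)) by move=> [? ?] [? ?] [-> ->].
rewrite -(card_imset _ swap_inj); apply: eq_card => -[a b]; rewrite mem_nonadj.
apply/imsetP/and3P => [[[b' a']] | [aA bB nab]].
  by rewrite mem_nonadj e_sym => /and3P[? ? ?] [-> ->].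
by exists (b, a) => //; rewrite mem_nonadj e_sym; apply/and3P.
Qed.

Lemma codeg_sub A B a : A \subset B -> codeg e A a <= codeg e B a.
Proof.
move=> AB; apply/subset_leq_card/subsetP => b; rewrite !inE => /andP[bA ->].
by rewrite (subsetP AB).
Qed.

Lemma has_alternating_cycle_swap A B :
  has_alternating_cycle e A B -> has_alternating_cycle e B A.
Proof.
case=> s [Us sAB cyc]; exists s; split=> //; first by rewrite setUC.
by rewrite (eq_cycle (e' := [rel u v | e u v && across A B u v])) // => u v;
   rewrite /= /across orbC.
Qed.

Lemma nonadj_remove A B x y :
  x \in A -> (forall a, a \in A -> e a y) ->
  #|nonadj e (A :\ x) (B :\ y)| + codeg e B x = #|nonadj e A B|.
Proof.
move=> xA ey; rewrite -(cardsID [set p | p.1 == x] (nonadj e A B)) addnC.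
congr (_ + _).
  have pair_inj : injective (@pair V V x) by move=> ? ? [].
  rewrite /codeg -(card_imset _ pair_inj).
  apply: eq_card => -[a b]; rewrite in_setI mem_nonadj inE /=.
  apply/imsetP/andP => [[b' + [-> ->]] | [/and3P[_ bB nab] /eqP <-]].
    by rewrite inE xA eqxx.
  by exists b; rewrite // inE bB.
apply: eq_card => -[a b]; rewrite in_setD !inE /=.
case: eqVneq => //= _; case aA: (a \in A) => //=.
by case: eqVneq => //= ->; rewrite ey ?andbF.
Qed.

(** Rotate the smaller cycle to start at [b]. Its last vertex lies in [A], and the closing edge from
    there to [b] is replaced by a detour through [y] and then [x]; as [y] is joined to all of [A],
    only [x b] needs a hypothesis. *)
Lemma alternating_cycle_insert A B x y b :
  [disjoint A & B] -> x \in A -> y \in B -> b \in B :\ y ->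
  e x b -> (forall a, a \in A -> e a y) ->
  has_alternating_cycle e (A :\ x) (B :\ y) -> has_alternating_cycle e A B.
Proof.
move=> dAB xA yB bB' exb ey [s [Us s_mem]].
have dBA z : z \in B -> z \notin A by move=> zB; rewrite (disjointFl dAB zB).
have sb : b \in s by rewrite s_mem inE bB' orbT.
have [k t rot_s] := rot_to sb.
rewrite -(rot_cycle k) rot_s; rewrite -(rot_uniq k) rot_s in Us.
have t_mem : b :: t =i A :\ x :|: B :\ y.
  by move=> z; rewrite -rot_s mem_rot s_mem.
rewrite /= rcons_path => /andP[pt /andP[eab acab]].
have xNy : x != y by apply: contraTneq xA => ->; apply: dBA.
have aA : last b t \in A.
  move: acab; rewrite /= /across => /orP[|]; first by rewrite !inE => /andP[/andP[]].
  move=> /andP[_]; rewrite !inE; move: bB'; rewrite !inE => /andP[_ /dBA/negPf->].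
  by rewrite andbF.
exists (b :: (t ++ [:: y; x])); split.
- have yNs : y \notin b :: t by rewrite t_mem !inE eqxx (negPf (dBA y yB)) andbF.
  have xNs : x \notin b :: t by rewrite t_mem !inE eqxx (disjointFr dAB xA) andbF.
  rewrite -cat_cons; move: (b :: t) Us yNs xNs => s' Us yNs xNs.
  by rewrite cat_uniq Us /= !inE (negPf yNs) (negPf xNs) eq_sym (negPf xNy).
- move=> z; rewrite -cat_cons mem_cat t_mem !inE.
  have [->|_] := eqVneq z x; first by rewrite xA /= !orbT.
  by have [->|_] := eqVneq z y; rewrite ?yB ?orbT ?orbF.
rewrite /= rcons_cat cat_path /= ey // e_sym ey // exb /across aA yB xA.
move: (bB'); rewrite inE => /andP[_ ->]; rewrite /= orbT !andbT.
apply: sub_path pt => u v /= /andP[->]; rewrite /across !inE.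
by case/orP=> /andP[/andP[_ ->] /andP[_ ->]]; rewrite ?orbT.
Qed.

Lemma alternating_cycle_two A B :
  #|A| = 2 -> #|B| = 2 -> [disjoint A & B] ->
  (forall a b, a \in A -> b \in B -> e a b) -> has_alternating_cycle e A B.
Proof.
move=> /eqP/cards2P[a [a' [aNa' eqA]]] /eqP/cards2P[b [b' [bNb' eqB]]] dAB eAB.
have [aA a'A] : a \in A /\ a' \in A by rewrite eqA !inE !eqxx orbT.
have [bB b'B] : b \in B /\ b' \in B by rewrite eqB !inE !eqxx orbT.
have dab u v : u \in A -> v \in B -> u != v.
  by move=> uA vB; apply: contraTneq uA => ->; rewrite (disjointFl dAB vB).
exists [:: a; b; a'; b']; split.
- by rewrite /= !inE !negb_or aNa' bNb' [b == a']eq_sym !dab.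
- move=> z; rewrite eqA eqB !inE.
  by case: (z == a); case: (z == a'); case: (z == b); rewrite ?orbT ?orbF.
- by rewrite /= /across ![e b _]e_sym ![e b' _]e_sym !eAB ?aA ?a'A ?bB ?b'B ?orbT.
Qed.

(* The nonadjacent pairs form a matching of size two: deleting [x] and [y] leaves
   K_{2,2} minus an edge, so the induction below does not apply. *)
Lemma alternating_cycle_three A B x y :
  #|A| = 3 -> #|B| = 3 -> [disjoint A & B] -> x \in A -> y \in B ->
  (forall a, a \in A -> e a y) -> codeg e B x = 1 ->
  (forall b, b \in B -> codeg e A b <= 1) ->
  #|nonadj e (A :\ x) (B :\ y)| = 1 -> has_alternating_cycle e A B.
Proof.
move=> cA cB dAB xA yB ey /eqP/cards1P[y0 Ny0] codegB /eqP/cards1P[[x' y'] Nxy].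
have : (x', y') \in nonadj e (A :\ x) (B :\ y) by rewrite Nxy set11.
rewrite mem_nonadj !inE => /and3P[/andP[x'Nx x'A] /andP[y'Ny y'B] ne'].
have : y0 \in [set b in B | ~~ e x b] by rewrite Ny0 set11.
rewrite inE => /andP[y0B ne0].
have y0Ny : y0 != y by apply: contraNneq ne0 => ->; apply: ey.
(* Otherwise [x] and [x'] would both miss [y0], against [codegB]. *)
have y0Ny' : y0 != y'.
  apply/eqP => eq_y; have := codegB y' y'B.
  rewrite leqNgt => /negP; apply; rewrite /codeg.
  have <- : #|[set x; x']| = 2 by rewrite cards2 eq_sym x'Nx.
  apply/subset_leq_card/subsetP => u /set2P[]->; rewrite inE e_sym.
    by rewrite xA -eq_y.
  by rewrite x'A.
have exb b : b \in B -> b != y0 -> e x b.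
  move=> bB; apply: contraNT => nxb.
  by rewrite -in_set1 -Ny0 inE bB.
have eab a b : a \in A -> b \in B -> a != x -> b != y ->
    (a != x') || (b != y') -> e a b.
  move=> aA bB ax bY; rewrite -negb_and; apply: contraNT => nab.
  by rewrite -xpair_eqE -in_set1 -Nxy mem_nonadj !inE ax aA bY bB.
have [x'' x''A] : exists z, z \in A :\ x :\ x'.
  apply/set0Pn; rewrite -card_gt0.
  have := cardsD1 x A; have := cardsD1 x' (A :\ x).
  by rewrite !inE x'Nx xA x'A; move: cA; clear; lia.
move: x''A; rewrite !inE => /and3P[x''Nx' x''Nx x''A].
have eqA : A = [set x; x'; x''].
  apply/esym/eqP; rewrite eqEcard cA; apply/andP; split.
    by rewrite !subUset !sub1set xA x'A.
  by rewrite setUC cardsU1 cards2 !inE negb_or x''Nx x''Nx' eq_sym x'Nx.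
have eqB : B = [set y; y'; y0].
  apply/esym/eqP; rewrite eqEcard cB; apply/andP; split.
    by rewrite !subUset !sub1set yB y'B.
  by rewrite setUC cardsU1 cards2 !inE negb_or y0Ny y0Ny' eq_sym y'Ny.
have dab u v : u \in A -> v \in B -> u != v.
  by move=> uA vB; apply: contraTneq uA => ->; rewrite (disjointFl dAB vB).
(* This cyclic order avoids the two missing pairs, [x y0] and [x' y']. *)
exists [:: x; y'; x''; y0; x'; y]; split.
- rewrite /= !inE !negb_or y'Ny y0Ny x''Nx' [x == x'']eq_sym x''Nx [x == x']eq_sym.
  by rewrite x'Nx [y' == y0]eq_sym y0Ny' [y' == x'']eq_sym [y' == x']eq_sym [y0 == x']eq_sym !dab.
- move=> z; rewrite eqA eqB !inE.
  by case: (z == x); case: (z == x'); case: (z == x''); case: (z == y);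
     case: (z == y'); rewrite ?orbT ?orbF.
- rewrite /= /across xA x'A x''A yB y'B y0B /= !orbT !andbT.
  rewrite exb //; last by rewrite eq_sym.
  rewrite ![e y' _]e_sym ![e y0 _]e_sym ![e y _]e_sym !ey //= !eab //= ?x''Nx' //.
  by rewrite y0Ny' orbT.
Qed.

(** The codegree bounds give every vertex two neighbours, as a cycle requires. With d the largest
    codegree and D the number of missing pairs, the deletion in the induction leaves D - d missing
    pairs and codegrees at most min(d, D - d) <= (n-1)/2. This is below n-2, the bound needed,
    unless n = 3 and d = D - d = 1. *)
Lemma alternating_cycle n A B :
  2 <= n -> #|A| = n -> #|B| = n -> [disjoint A & B] -> #|nonadj e A B| < n ->
  (forall a, a \in A -> codeg e B a < n.-1) ->
  (forall b, b \in B -> codeg e A b < n.-1) -> has_alternating_cycle e A B.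
Proof.
case: n => [|[|m]] // _; elim: m A B => [|m IHm] A B cA cB dAB.
  move=> _ codegA _; apply: alternating_cycle_two => // a b aA bB.
  apply: contraTT (codegA a aA) => nab; rewrite -leqNgt /= /codeg card_gt0.
  by apply/set0Pn; exists b; rewrite inE bB.
(* [x] has the largest number of non-neighbours; delete [x] together with a vertex
   [y] adjacent to the whole of the other side. *)
have max_left A' B' x : #|A'| = m.+3 -> #|B'| = m.+3 -> [disjoint A' & B'] ->
    #|nonadj e A' B'| < m.+3 -> x \in A' -> codeg e B' x < m.+2 ->
    (forall a, a \in A' -> codeg e B' a <= codeg e B' x) ->
    (forall b, b \in B' -> codeg e A' b <= codeg e B' x) ->
    has_alternating_cycle e A' B'.
  move=> {A B cA cB dAB}; move: A' B' => A B cA cB dAB ltD xA ltx maxA maxB.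
  (* Fewer than [#|B|] missing pairs cannot meet every vertex of [B]. *)
  have [y yB ey] : exists2 y, y \in B & forall a, a \in A -> e a y.
    have /subsetPn[y yB yN] : ~~ (B \subset snd @: nonadj e A B).
      apply: contraL ltD => /subset_leq_card; rewrite cB -leqNgt => leB.
      exact: leq_trans leB (leq_imset_card _ _).
    exists y => // a aA; apply: contraNT yN => nay.
    by apply/imsetP; exists (a, y); rewrite // mem_nonadj aA yB.
  have eqD := nonadj_remove B xA ey.
  have cA' : #|A :\ x| = m.+2 by have := cardsD1 x A; rewrite xA; lia.
  have cB' : #|B :\ y| = m.+2 by have := cardsD1 y B; rewrite yB; lia.
  have dAB' : [disjoint A :\ x & B :\ y].
    by apply: disjointWl (subD1set _ _) (disjointWr (subD1set _ _) dAB).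
  have leA a : a \in A :\ x -> codeg e (B :\ y) a <= minn (codeg e B x)
      #|nonadj e (A :\ x) (B :\ y)|.
    move=> aA'; rewrite leq_min codeg_le_nonadj // andbT.
    rewrite (leq_trans (codeg_sub _ (subD1set _ _))) // maxA //.
    by move: aA'; rewrite inE => /andP[].
  have leB b : b \in B :\ y -> codeg e (A :\ x) b <= minn (codeg e B x)
      #|nonadj e (A :\ x) (B :\ y)|.
    move=> bB'; rewrite leq_min -nonadj_swap codeg_le_nonadj // andbT.
    rewrite (leq_trans (codeg_sub _ (subD1set _ _))) // maxB //.
    by move: bB'; rewrite inE => /andP[].
  (* A zero maximum means that nothing is missing; otherwise deleting [x] lowers the number of
     missing pairs, as the induction needs. *)
  have [x0 | x_gt0] := posnP (codeg e B x).
    have leD : #|nonadj e (A :\ x) (B :\ y)| = 0.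
      apply/eqP; rewrite cards_eq0; apply/eqP/setP => -[a b].
      rewrite in_set0 mem_nonadj !inE; apply/negP => /and3P[/andP[_ aA] /andP[_ bB] nab].
      have := maxA a aA; rewrite x0 leqn0 cards_eq0 => /eqP/setP/(_ b).
      by rewrite !inE bB nab.
    have [b bB'] : exists b, b \in B :\ y by apply/set0Pn; rewrite -card_gt0 cB'.
    apply: (alternating_cycle_insert dAB xA yB bB') => //.
      move: x0 => /eqP; rewrite cards_eq0 => /eqP/setP/(_ b); rewrite !inE.
      by move: bB'; rewrite inE => /andP[_ ->] /negbFE.
    apply: IHm => // [|a /leA|c /leB]; first by rewrite leD.
      by rewrite leD minn0 leqn0 => /eqP->.
    by rewrite leD minn0 leqn0 => /eqP->.
  have [/and3P[/eqP m0 /eqP x1 /eqP D1] | nspecial] :=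
    boolP [&& m == 0, codeg e B x == 1 & #|nonadj e (A :\ x) (B :\ y)| == 1].
    rewrite m0 in cA cB.
    by apply: (alternating_cycle_three cA cB dAB xA yB ey x1) => // b /maxB; rewrite x1.
  have [b bB' exb] : exists2 b, b \in B :\ y & e x b.
    have /subsetPn[b bB' bN] : ~~ (B :\ y \subset [set b in B | ~~ e x b]).
      apply: contraL ltx => /subset_leq_card; rewrite cB' -leqNgt; exact.
    exists b => //; move: bB' bN; rewrite !inE => /andP[_ ->].
    by rewrite negbK.
  apply: (alternating_cycle_insert dAB xA yB bB') => //.
  apply: IHm => // [|a /leA|b' /leB]; first by lia.
    by lia.
  by lia.
move=> ltD codegA codegB.
(* The maximum is taken over both sides at once; if it is reached in [B], the sides trade roles. *)
pose d v := if v \in A then codeg e B v else codeg e A v.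
have [a0 a0A] : exists a, a \in A by apply/set0Pn; rewrite -card_gt0 cA.
have a0AB : a0 \in A :|: B by rewrite inE a0A.
case: (arg_maxnP (P := [pred v | v \in A :|: B]) d a0AB) => x /= xAB max_x.
have maxA a : a \in A -> codeg e B a <= d x.
  by move=> aA; apply: leq_trans (max_x a _); rewrite /d ?aA // inE aA.
have maxB b : b \in B -> codeg e A b <= d x.
  move=> bB; apply: leq_trans (max_x b _); last by rewrite inE bB orbT.
  by rewrite /d (disjointFl dAB bB).
have [xA | xNA] := boolP (x \in A).
  by apply: (max_left A B x) => //; [exact: codegA | move: maxA | move: maxB];
     rewrite /d xA.
have xB : x \in B by move: xAB; rewrite inE (negPf xNA).
apply/has_alternating_cycle_swap/(max_left B A x) => //.
- by rewrite disjoint_sym.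
- by rewrite nonadj_swap.
- exact: codegB.
- by move: maxB; rewrite /d (negPf xNA).
- by move: maxA; rewrite /d (negPf xNA).
Qed.

End AlternatingCycle.

Lemma nonadj_sum (V : finType) (e : rel V) (A B : {set V}) :
  #|nonadj e A B| = \sum_(a in A) codeg e B a.
Proof.
rewrite /nonadj -sum1dep_card.
rewrite (eq_bigl (fun p => (p.1 \in A) && ((p.2 \in B) && ~~ e p.1 p.2))); last first.
  by move=> p; rewrite inE andbA.
rewrite -(pair_big_dep (fun a => a \in A) (fun a b => (b \in B) && ~~ e a b) (fun _ _ => 1)).
by apply: eq_bigr => a _; rewrite sum1dep_card.
Qed.

Lemma nonadj_compl (V : finType) (e : rel V) (A B : {set V}) :
  #|nonadj e A B| + #|nonadj (fun u v => ~~ e u v) A B| = #|A| * #|B|.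
Proof.
rewrite -cardsX -(cardsID [set p | ~~ e p.1 p.2] (setX A B)).
congr (_ + _); apply: eq_card => p; rewrite !inE //.
by rewrite andbC.
Qed.

(** * The extremal graph *)

(** The centre of the missing star is [inr (inr _)], with [inl (inl _)] as its only neighbour;
    [inr (inl _)] and [inl (inr _)] are the remaining vertices of the left and right sides. *)
Lemma adj_extremal n u v : adj (extremal n) u v =
  match u, v with
  | inl (inl _), inl (inr _) | inl (inr _), inl (inl _)
  | inl (inl _), inr (inr _) | inr (inr _), inl (inl _)
  | inl (inr _), inr (inl _) | inr (inl _), inl (inr _) => true
  | _, _ => false
  end.
Proof.
have inX s t (w : 'I_s + 'I_t) :
    (w \in [set inl i | i : 'I_s]) = if w is inl _ then true else false.
  by case: w => i; [rewrite imset_f | apply/imsetP => -[]].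
have inY s t (w : 'I_s + 'I_t) :
    (w \in [set inr i | i : 'I_t]) = if w is inr _ then true else false.
  by case: w => i; [apply/imsetP => -[] | rewrite imset_f].
by case: u => -[?|?]; case: v => -[?|?]; rewrite /= /across /= ?inX ?inY.
Qed.

Lemma isomorphic_extremal (V : finType) (G : sgraph V) (A B : {set V}) m x0 y0 :
  is_bipartition G A B -> #|A| = m.+2 -> #|B| = m.+2 -> x0 \in A -> y0 \in B ->
  (forall a b, a \in A -> b \in B -> adj G a b = (b != y0) || (a == x0)) ->
  isomorphic G (extremal m.+2).
Proof.
case=> dAB cAB bip cA cB x0A y0B adjE.
pose idx (S : {set V}) u : 'I_m.+1 := inord (index u (enum S)).
have idx_inj (S : {set V}) : #|S| = m.+1 -> {in S &, injective (idx S)}.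
  move=> cS u v uS vS /(congr1 (@nat_of_ord _)); rewrite !inordK -?cS ?cardE ?index_mem ?mem_enum //.
  by move=> eq_uv; rewrite -[u](nth_index u (s := enum S)) ?mem_enum // eq_uv nth_index ?mem_enum.
have cA' : #|A :\ x0| = m.+1 by have := cardsD1 x0 A; rewrite x0A; lia.
have cB' : #|B :\ y0| = m.+1 by have := cardsD1 y0 B; rewrite y0B; lia.
pose f u : ('I_1 + 'I_m.+1) + ('I_m.+1 + 'I_1) :=
  if u == x0 then inl (inl ord0) else if u == y0 then inr (inr ord0) else
  if u \in A then inr (inl (idx (A :\ x0) u)) else inl (inr (idx (B :\ y0) u)).
have inB u : (u \in B) = (u \notin A).
  have := in_setT u; rewrite -cAB inE.
  by have [uA _|_ /= ->//] := boolP (u \in A); rewrite (disjointFr dAB uA).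
have f_inj : injective f.
  move=> u v; rewrite /f.
  have [eu|ux] := eqVneq u x0; have [ev|vx] := eqVneq v x0; try by rewrite eu ev.
  - by case: ifP => // _; case: ifP.
  - by case: ifP => // _; case: ifP.
  have [eu|uy] := eqVneq u y0; have [ev|vy] := eqVneq v y0; try by rewrite eu ev.
  - by case: ifP.
  - by case: ifP.
  have [uA|uA] := boolP (u \in A); have [vA|vA] := boolP (v \in A) => //.
    by case=> /idx_inj; rewrite !inE ux uA vx vA; apply.
  by case=> /idx_inj; rewrite !inE !inB uy uA vy vA; apply.
exists f.
  apply: inj_card_bij => //; rewrite !card_sum !card_ord.
  have := cardsU A B; rewrite cAB cardsT cA cB.
  by move: dAB; rewrite -setI_eq0 => /eqP->; rewrite cards0; lia.
have adjf a b : a \in A -> b \in B -> adj G a b = adj (extremal m.+2) (f a) (f b).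
  move=> aA bB; rewrite adjE // adj_extremal /f aA.
  have bNA : b \in A = false by move: bB; rewrite inB => /negPf.
  rewrite bNA; have -> : (b == x0) = false by apply: contraFF bNA => /eqP->.
  have -> : (a == y0) = false by move: y0B; rewrite inB; apply: contraNF => /eqP<-.
  by case: (a == x0); case: (b == y0).
have fA u : u \in A -> f u = inl (inl ord0) \/ exists i, f u = inr (inl i).
  move=> uA; rewrite /f uA; have [_|_] := eqVneq u x0; first by left.
  by have [eu|_] := eqVneq u y0; [move: y0B; rewrite inB -eu uA | right; eexists].
have fB u : u \in B -> f u = inr (inr ord0) \/ exists i, f u = inl (inr i).
  rewrite inB => uA; rewrite /f (negPf uA).
  have [eu|_] := eqVneq u x0; first by move: uA; rewrite eu x0A.
  by have [_|_] := eqVneq u y0; [left | right; eexists].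
move=> u v; have [uA|uB] := boolP (u \in A); have [vA|vB] := boolP (v \in A).
- rewrite adj_extremal; have [->|[i ->]] := fA u uA; have [->|[j ->]] := fA v vA => //=;
  by apply/negP => /bip; rewrite /across !inB uA vA.
- by apply: adjf; rewrite ?inB.
- by rewrite adj_sym [RHS]adj_sym; apply: adjf; rewrite ?inB.
- rewrite -!inB in uB vB.
  rewrite adj_extremal; have [->|[i ->]] := fB u uB; have [->|[j ->]] := fB v vB => //=;
  by apply/negP => /bip; rewrite /across (disjointFl dAB uB) (disjointFl dAB vB) ?andbF.
Qed.

(** The pairs missed at [b] use up the whole allowance of [m.+1], so every other vertex of [B] is
    joined to all of [A], and [b] keeps exactly one neighbour. *)
Lemma star_isomorphic_extremal (V : finType) (G : sgraph V) (A B : {set V}) m b :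
  is_bipartition G A B -> #|A| = m.+2 -> #|B| = m.+2 -> b \in B ->
  #|nonadj (adj G) B A| <= m.+1 -> m.+1 <= codeg (adj G) A b ->
  isomorphic G (extremal m.+2).
Proof.
move=> bip cA cB bB leN leb.
have eqb : codeg (adj G) A b = m.+1.
  by apply/eqP; rewrite eqn_leq leb andbT; apply: leq_trans leN; apply: codeg_le_nonadj.
have other b' a : b' \in B -> b' != b -> a \in A -> adj G b' a.
  move=> b'B nb aA; move: leN; rewrite nonadj_sum (bigD1 b) //= eqb.
  rewrite -[X in _ <= X]addn0 leq_add2l leqn0 sum_nat_eq0 => /forall_inP/(_ b').
  rewrite b'B nb /codeg cards_eq0 => /(_ isT)/eqP/setP/(_ a).
  by rewrite !inE aA => /negbFE.
have /eqP/cards1P[x0 Nx0] : #|[set a in A | adj G b a]| = 1.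
  have := cardsID [set a | ~~ adj G b a] A; rewrite cA.
  have -> : A :&: [set a | ~~ adj G b a] = [set a in A | ~~ adj G b a].
    by apply/setP => a; rewrite !inE.
  have -> : A :\: [set a | ~~ adj G b a] = [set a in A | adj G b a].
    by apply/setP => a; rewrite !inE negbK andbC.
  rewrite -[#|[set a in A | ~~ _]|]/(codeg (adj G) A b) eqb; lia.
have x0P a : a \in A -> adj G b a = (a == x0).
  by move=> aA; rewrite -in_set1 -Nx0 inE aA.
apply: (isomorphic_extremal bip cA cB (x0 := x0) (y0 := b)) => //.
  by have := set11 x0; rewrite -Nx0 inE => /andP[].
move=> a b' aA b'B; have [->|nb] /= := eqVneq b' b; first by rewrite adj_sym x0P.
by rewrite adj_sym other.
Qed.

(** * Rainbow Hamilton cycles *)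

Lemma top_subset (T : finType) (E : {set T}) (m : T -> nat) k :
  k <= #|E| -> exists S : {set T},
  [/\ S \subset E, #|S| = k & forall e f, e \in S -> f \in E :\: S -> m f <= m e].
Proof.
elim: k => [|k IHk] leE; first by exists set0; rewrite sub0set cards0; split=> // e f; rewrite inE.
have [S [SE cS topS]] := IHk (ltnW leE).
have /card_gt0P[e0 e0D] : 0 < #|E :\: S| by rewrite cardsD (setIidPr SE); lia.
case: (arg_maxnP (P := [pred e | e \in E :\: S]) m e0D) => e /= eD max_e.
have [eS eE] := setDP eD.
exists (e |: S); split; first by rewrite subUset sub1set eS.
  by rewrite cardsU1 eE cS.
move=> g f /setU1P[->|gS]; rewrite !inE negb_or => /andP[/andP[_ fS] fE].
  by apply: max_e; rewrite inE fS.
by apply: topS => //; rewrite inE fS.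
Qed.

(** The second inequality makes the edges leaving different vertices of a cycle different; it fails
    on two vertices. *)
Lemma next_neq (T : eqType) (s : seq T) u :
  uniq s -> 2 < size s -> u \in s -> (next s u != u) && (next s (next s u) != u).
Proof.
move=> Us s2 us; have [i t rot_s] := rot_to us.
have := Us; have := size_rot i s; rewrite -(rot_uniq i) -!(next_rot i Us) rot_s.
case: t {rot_s} => [|v [|w t]] /= size_s; [lia|lia|].
rewrite !inE !negb_or eqxx => /and4P[/and3P[uv uw _] _ _ _].
by rewrite ![v == u]eq_sym (negPf uv) eqxx eq_sym uw.
Qed.

(** Each edge of the cycle is named by the vertex it leaves, so an edge colouring is a map [f] on
    vertices; injectivity suffices, as there are as many vertices as colours. *)
Lemma rainbow_of_cycle (V : finType) (k : nat) (G : 'I_k -> sgraph V)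
    (s : seq V) (f : V -> 'I_k) :
  uniq s -> 2 < size s -> (forall v, v \in s) -> #|V| = k -> injective f ->
  (forall u, adj (G (f u)) u (next s u)) -> has_rainbow_hamilton_cycle G.
Proof.
move=> Us s2 s_all cV f_inj adjf.
have nextN u := next_neq Us s2 (s_all u).
pose eH := [rel u v | (next s u == v) || (next s v == u)].
have eH_sym : symmetric eH by move=> u v; rewrite /= orbC.
have eH_irr : irreflexive eH.
  by move=> u; rewrite /= orbb; apply/negbTE; case/andP: (nextN u).
pose H := SGraph eH_sym eH_irr; pose edge u := [set u; next s u].
exists H; first by exists s.
have edge_inj : injective edge.
  move=> u v /setP euv; have := euv u; have := euv (next s u).
  rewrite !inE !eqxx orbT /= => /esym/orP[/eqP nu|/eqP nu] /esym/orP[/eqP-> // | /eqP eu].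
    by move: (nextN v); rewrite -eu nu eqxx andbF.
  by apply: (can_inj (prev_next Us)).
have edgesH : edges H = edge @: V.
  apply/setP => e; apply/imsetP/imsetP => [[[u v] /= + ->] | [u _ ->]].
    rewrite inE /= => /orP[/eqP<-|/eqP<-]; first by exists u.
    by exists v; rewrite // /edge setUC.
  by exists (u, next s u); rewrite // inE /= eqxx.
have u0 : V by move: s2; case: (s) => // u *; exact: u.
(* The default [u0] only serves sets that are not edges of the cycle. *)
pose phi e := f (odflt u0 [pick u | e == edge u]).
have phiE u : phi (edge u) = f u.
  rewrite /phi; case: pickP => [v /eqP/edge_inj-> // | /(_ u)].
  by rewrite eqxx.
exists phi; rewrite edgesH; split.
- by move=> _ _ /imsetP[u _ ->] /imsetP[v _ ->]; rewrite !phiE => /f_inj->.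
- apply/eqP; rewrite eqEcard subsetT cardsT card_ord -imset_comp.
  by rewrite (eq_imset _ (phiE : phi \o edge =1 f)) card_imset ?cV /=.
- move=> _ /imsetP[u _ ->]; rewrite phiE; apply/imsetP.
  by exists (u, next s u); rewrite // inE /=.
Qed.

Lemma sum_card_exchange (I T : finType) (M : I -> {set T}) :
  \sum_e #|[set i | e \in M i]| = \sum_i #|M i|.
Proof.
under eq_bigr do rewrite -sum1dep_card big_mkcond.
rewrite exchange_big /=; apply: eq_bigr => i _.
by rewrite -big_mkcond sum1_card.
Qed.

Lemma same_graph_of_nonadj (V : finType) (G H : sgraph V) (X Y : {set V}) :
  is_bipartition G X Y -> is_bipartition H X Y ->
  nonadj (adj G) X Y = nonadj (adj H) X Y -> same_graph G H.
Proof.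
case=> _ _ bG [_ _ bH] /setP eqN.
have adjE u v : u \in X -> v \in Y -> adj G u v = adj H u v.
  by move=> uX vY; apply: negb_inj; have := eqN (u, v); rewrite !mem_nonadj uX vY.
move=> u v; case: (boolP (across X Y u v)) => [/orP[] /andP[uX vY] | nac].
- exact: adjE.
- by rewrite adj_sym [RHS]adj_sym adjE.
- by rewrite (contraNF (bG u v) nac) (contraNF (bH u v) nac).
Qed.

(** With a = t - 2 and b = m + 1 - t, the product in the first bound exceeds [2 * m.+2 * m.+1] by (a
    + 1)(b + 3). *)
Lemma hall_deficiency_bound m t M :
  2 <= t <= m.+1 -> (m + t) * (2 * m.+2 - t).+1 <= M -> M <= 2 * m.+2 * m.+1 -> False.
Proof.
case: t => [|[|a]] //= le_a h1 h2.
have [b eqm] : exists b, m = a + b.+1 by exists (m - a).-1; lia.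
have := leq_trans h1 h2; rewrite eqm.
have -> : (2 * (a + b.+1).+2 - a.+2).+1 = (a + 2 * b + 5) by lia.
nia.
Qed.

(** * Families in which every graph misses at most n-1 pairs, with n = [m.+2] *)

Section RainbowHamiltonCycle.

Variables (V : finType) (m : nat) (X Y : {set V}) (G : 'I_(2 * m.+2) -> sgraph V).
Hypotheses (cX : #|X| = m.+2) (cY : #|Y| = m.+2).
Hypothesis bipG : forall i, is_bipartition (G i) X Y.
Hypothesis leM : forall i, #|nonadj (adj (G i)) X Y| <= m.+1.

Let i0 : 'I_(2 * m.+2) := ord0.
Let dXY : [disjoint X & Y]. Proof. by case: (bipG i0). Qed.
Let cXY : X :|: Y = [set: V]. Proof. by case: (bipG i0). Qed.

Let cardV : #|V| = 2 * m.+2.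
Proof.
have := cardsU X Y; rewrite cXY cardsT cX cY.
by move: dXY; rewrite -setI_eq0 => /eqP->; rewrite cards0; lia.
Qed.

Let cycle_facts e (s : seq V) : uniq s -> s =i X :|: Y ->
    cycle [rel u v | e u v && across X Y u v] s ->
  [/\ 2 < size s, forall u, u \in s &
      forall u, e u (next s u) /\ across X Y u (next s u)].
Proof.
move=> Us s_mem cyc.
have s_all u : u \in s by rewrite s_mem cXY inE.
split=> // [|u]; last by apply/andP/(next_cycle cyc).
by rewrite -(card_uniqP Us) (eq_card (B := V)) ?cardV //; lia.
Qed.

Let swap_bip i : is_bipartition (G i) Y X.
Proof.
case: (bipG i) => d c b; split; rewrite 1?disjoint_sym 1?setUC // => u v /b.
by rewrite /across orbC.
Qed.

Lemma rainbow_of_common_nonadj (D : {set V * V}) :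
  (forall i, nonadj (adj (G i)) X Y = D) ->
  (forall i, isomorphic (G i) (extremal m.+2)) \/ has_rainbow_hamilton_cycle G.
Proof.
move=> eqD.
have same i j : same_graph (G i) (G j).
  by apply: (same_graph_of_nonadj (bipG i) (bipG j)); rewrite !eqD.
pose e := adj (G i0).
have codegE i A v : codeg (adj (G i)) A v = codeg e A v.
  by apply: eq_card => u; rewrite !inE (same i i0).
have [/exists_inP[a aX lea] | /exists_inPn codegX] :=
    boolP [exists a in X, m.+1 <= codeg e Y a].
  (* The centre lies in [X], so the two sides are exchanged. *)
  left=> i; apply: (star_isomorphic_extremal (swap_bip i) cY cX aX) => //.
  by rewrite codegE.
have [/exists_inP[b bY leb] | /exists_inPn codegY] :=
    boolP [exists b in Y, m.+1 <= codeg e X b].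
  left=> i; apply: (star_isomorphic_extremal (bipG i) cX cY bY) => //.
    by rewrite nonadj_swap // => u v; apply: adj_sym.
  by rewrite codegE.
right.
have e_sym : symmetric e by apply: adj_sym.
have [|a aX|b bY|s [Us s_mem cyc]] := alternating_cycle e_sym (isT : 1 < m.+2) cX cY dXY.
- by rewrite ltnS leM.
- by rewrite ltnNge codegX.
- by rewrite ltnNge codegY.
have [s2 s_all adj_next] := cycle_facts Us s_mem cyc.
apply: (rainbow_of_cycle (f := fun u => cast_ord cardV (enum_rank u)) Us s2 s_all cardV).
  by move=> u v /cast_ord_inj/enum_rank_inj.
by move=> u; rewrite (same _ i0); case: (adj_next u).
Qed.

Lemma rainbow_of_few_dead_pairs :
  #|[set p | [forall i, p \in nonadj (adj (G i)) X Y]]| <= m ->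
  has_rainbow_hamilton_cycle G.
Proof.
set D := [set p | _] => leD; pose M i := nonadj (adj (G i)) X Y.
pose w p := #|[set i | p \in M i]|.
have [|T [TE cT topT]] := @top_subset _ (setX X Y) w m.
  by rewrite cardsX cX cY; nia.
pose e := [rel u v | ((u, v) \notin T) && ((v, u) \notin T)].
have e_sym : symmetric e by move=> u v; rewrite /= andbC.
have XNY u : u \in X -> u \in Y = false by move=> uX; apply: disjointFr uX.
have YNX u : u \in Y -> u \in X = false by move=> uY; apply: disjointFl uY.
have leT : #|nonadj e X Y| <= m.
  rewrite -cT; apply/subset_leq_card/subsetP => -[a b].
  rewrite mem_nonadj /= negb_and !negbK => /and3P[aX bY /orP[//|/(subsetP TE)]].
  by rewrite in_setX (YNX b bY).
have [|a aX|b bY|s [Us s_mem cyc]] := alternating_cycle e_sym (isT : 1 < m.+2) cX cY dXY.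
- by rewrite ltnS ltnW // ltnS.
- by rewrite ltnS; apply: leq_trans (codeg_le_nonadj _ _ aX) leT.
- rewrite ltnS; apply: leq_trans (codeg_le_nonadj _ _ bY) _.
  by rewrite nonadj_swap.
have [s2 s_all next_s] := cycle_facts Us s_mem cyc.
(* The edge leaving [u], turned to start in [X] like the pairs of [T] and [M i]. *)
pose p u := if u \in X then (u, next s u) else (next s u, u).
have pE u : p u \in setX X Y :\: T.
  have [/andP[n1 n2]] := next_s u; rewrite /p.
  case/orP=> /andP[uX vY]; first by rewrite uX in_setD n1 in_setX uX vY.
  by rewrite (YNX _ uX) in_setD n2 in_setX uX vY.
have p_inj : injective p.
  move=> u v; rewrite /p; have := next_neq Us s2 (s_all v) => /andP[_ nn].
  case: ifP => _; case: ifP => _ [] // eu ev; move: nn.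
    by rewrite -eu ev eqxx.
  by rewrite -ev eu eqxx.
have [J | f f_inj fA] := @hall_marriage _ _ (fun u => [set i | p u \notin M i]).
  rewrite leqNgt; apply/negP => ltJ.
  (* Every colour in [~: U] misses all the edges [p u] with [u] in [J]. *)
  set U := \bigcup_(_ in _) _ in ltJ.
  have cU := cardsC U; rewrite card_ord in cU.
  have leJ : #|J| <= 2 * m.+2 by rewrite -cardV max_card.
  have allM i u : i \in ~: U -> u \in J -> p u \in M i.
    move=> iU uJ; move: iU; rewrite inE; apply: contraNT => puM.
    by apply/bigcupP; exists u; rewrite // inE.
  have [i1 i1U] : exists i, i \in ~: U by apply/set0Pn; rewrite -card_gt0; lia.
  have [u1 u1J] : exists u, u \in J by apply/set0Pn; rewrite -card_gt0; lia.
  have cJ : #|p @: J| = #|J| by rewrite card_imset.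
  have leJm : #|J| <= m.+1.
    rewrite -cJ; apply: leq_trans (leM i1); apply/subset_leq_card/subsetP.
    by move=> _ /imsetP[u uJ ->]; apply: allM.
  have wJ u : u \in J -> #|~: U| <= w (p u).
    by move=> uJ; apply/subset_leq_card/subsetP => i iU; rewrite inE allM.
  (* No edge of the cycle lies in [T], so each pair of [T] weighs at least as much as [p u1]. *)
  have wW q : q \in T :|: p @: J -> #|~: U| <= w q.
    rewrite inE => /orP[qT | /imsetP[u uJ ->]]; last exact: wJ.
    by apply: leq_trans (wJ _ u1J) _; apply: topT.
  have cW : #|T :|: p @: J| = m + #|J|.
    rewrite cardsU cT cJ (_ : T :&: _ = set0) ?cards0 ?subn0 //.
    apply/setP => q; rewrite !inE; apply/negP => /andP[qT /imsetP[u _ eq_q]].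
    by have := pE u; rewrite -eq_q in_setD qT.
  (* Double counting: the weights of all pairs add up to the numbers of pairs missed by the
     [2 * m.+2] graphs, each at most [m.+1]. *)
  have le_sum : (m + #|J|) * #|~: U| <= 2 * m.+2 * m.+1.
    apply: (@leq_trans (\sum_(q in T :|: p @: J) w q)).
      by rewrite -cW -sum_nat_const; apply: leq_sum.
    apply: (@leq_trans (\sum_q w q)).
      by rewrite [leqRHS](bigID (mem (T :|: p @: J))) /= leq_addr.
    rewrite sum_card_exchange; apply: (@leq_trans (\sum_(i < 2 * m.+2) m.+1)).
      by apply: leq_sum => i _; apply: leM.
    by rewrite sum_nat_const card_ord.
  have [J2 | J1] := ltnP 1 #|J|.
    apply: (@hall_deficiency_bound m #|J| ((m + #|J|) * #|~: U|)) => //.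
      by rewrite J2.
    by rewrite leq_mul2l; apply/orP; right; lia.
  (* With [#|J| = 1] the set [U] is empty, so the [m.+1] pairs counted by [cW] are missed by every
     graph, against [leD]. *)
  have cJ1 : #|J| = 1 by apply/eqP; rewrite eqn_leq J1 card_gt0; apply/set0Pn; exists u1.
  have /subset_leq_card : T :|: p @: J \subset D.
    apply/subsetP => q /wW le_w; rewrite inE; apply/forallP => i.
    have : [set i | q \in M i] = setT.
      apply/eqP; rewrite eqEcard subsetT cardsT card_ord.
      by apply: leq_trans le_w; lia.
    by move/setP/(_ i); rewrite !inE.
  by rewrite cW cJ1 addn1 leqNgt ltnS leD.
apply: (rainbow_of_cycle Us s2 s_all cardV f_inj) => u.
have := fA u; rewrite inE; have := pE u; rewrite /M /p.
case: ifP => _; rewrite in_setD in_setX mem_nonadj => /and3P[_ -> ->]; rewrite negbK //.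
by rewrite adj_sym.
Qed.

Lemma rainbow_hamilton_cycle :
  ~ ((forall i j, same_graph (G i) (G j)) /\
     (forall i, isomorphic (G i) (extremal m.+2))) ->
  has_rainbow_hamilton_cycle G.
Proof.
move=> not_ext; pose M i := nonadj (adj (G i)) X Y.
have [|ltD] := leqP #|[set p | [forall i, p \in M i]]| m.
  exact: rainbow_of_few_dead_pairs.
(* The dead pairs lie in every [M i] and are at least as many as [M i] can hold. *)
have eqM i : M i = [set p | [forall i, p \in M i]].
  apply/esym/eqP; rewrite eqEcard (leq_trans (leM i) ltD) andbT.
  by apply/subsetP => p; rewrite inE => /forallP.
have [iso|//] := rainbow_of_common_nonadj eqM.
case: not_ext; split=> // i j.
by apply: (same_graph_of_nonadj (bipG i) (bipG j)); rewrite -/(M i) -/(M j) !eqM.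
Qed.

End RainbowHamiltonCycle.

(** * Spectral radius and number of edges *)

Local Open Scope ring_scope.

(** Cauchy-Schwarz against the constant 1; after doubling, it is 2ab <= a^2 + b^2 summed over all
    ordered pairs of values. *)
Lemma sqr_sum_le_card (R : numFieldType) (I : finType) (P : pred I) (f : I -> R) :
  (forall i, 0 <= f i) ->
  (\sum_(i | P i) f i) ^+ 2 <= #|P|%:R * \sum_(i | P i) f i ^+ 2.
Proof.
move=> f_ge0; rewrite -(ler_pMn2r (ltn0Sn 1)) expr2 mulr_suml -sumrMnl.
apply: (@le_trans _ _ (\sum_(i | P i) \sum_(j | P j) (f i ^+ 2 + f j ^+ 2))).
  apply: ler_sum => i _; rewrite mulr_sumr -sumrMnl; apply: ler_sum => j _.
  by apply: (real_leif_mean_square_scaled _ _).1; apply: ger0_real.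
under eq_bigr do rewrite big_split /= sumr_const.
by rewrite big_split /= sumr_const sumrMnl mulr_natl mulr2n.
Qed.

Section SpectralRadius.

Variables (m : nat) (A : 'M[algC]_m).

Lemma eigenvalue_le_spectral_radius z : eigenvalue A z -> `|z| <= spectral_radius A.
Proof.
rewrite -mem_eigenvalues /spectral_radius; elim: (eigenvalues A) => // y s IHs.
have nreal (t : algC) : `|t| \is Num.real by apply: ger0_real; apply: normr_ge0.
have cmp : `|y| >=< \big[Num.max/0]_(x <- s) `|x|.
  by apply: real_comparable => //; apply: bigmax_real => // *; apply: nreal.
rewrite big_cons inE comparable_le_max // => /predU1P[->|/IHs->]; last exact: orbT.
by rewrite lexx.
Qed.

Lemma spectral_radius_attained :
  spectral_radius A = 0 \/ exists2 z, eigenvalue A z & spectral_radius A = `|z|.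
Proof.
suff : spectral_radius A = 0 \/
    exists2 z, z \in eigenvalues A & spectral_radius A = `|z|.
  by case=> [|[z zA ?]]; [left | right; exists z; rewrite -?mem_eigenvalues].
rewrite /spectral_radius; elim: (eigenvalues A) => [|y s IHs].
  by rewrite big_nil; left.
rewrite big_cons /Num.max; case: ifP => _; last first.
  by right; exists y; rewrite ?mem_head.
case: IHs => [->|[z zs ->]]; [by left | right].
by exists z; rewrite // inE zs orbT.
Qed.

End SpectralRadius.

Lemma adjacency_mul (V : finType) (G : sgraph V) (v : 'rV[algC]_#|V|) w :
  (v *m adjacency G) 0 (enum_rank w) = \sum_(u | adj G u w) v 0 (enum_rank u).
Proof.
rewrite mxE (reindex enum_rank) /=; last by apply: onW_bij; apply: enum_rank_bij.
rewrite [RHS]big_mkcond; apply: eq_bigr => u _.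
by rewrite mxE !enum_rankK; case: adj; rewrite ?mulr1 ?mulr0.
Qed.

(** Cauchy-Schwarz at a vertex [w] bounds [|z|^2 |v_w|^2] by the degree of [w] times the squared
    norm of [v] on the opposite side. Summing over each side in turn and adding compares both sides
    of the claim multiplied by the full squared norm of [v], which is positive. *)
Lemma eigenvalue_sqr_le (V : finType) (G : sgraph V) (X Y : {set V}) z :
  is_bipartition G X Y -> eigenvalue (adjacency G) z ->
  `|z| ^+ 2 <= #|nonadj (fun u v => ~~ adj G u v) X Y|%:R.
Proof.
case=> dXY cXY bip /eigenvalueP[v vA v_neq0].
set ng := fun u v => ~~ adj G u v.
pose f u := `|v 0 (enum_rank u)|.
have f_ge0 u : 0 <= f u by apply: normr_ge0.
have f2_ge0 u : 0 <= f u ^+ 2 by apply: exprn_ge0.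
have zf w : `|z| * f w <= \sum_(u | adj G u w) f u.
  rewrite /f -normrM; have -> : z * v 0 (enum_rank w) = (z *: v) 0 (enum_rank w).
    by rewrite mxE.
  by rewrite -vA adjacency_mul; apply: ler_norm_sum.
have half (A B : {set V}) : (forall u w, w \in B -> adj G u w -> u \in A) ->
    \sum_(w in B) `|z| ^+ 2 * f w ^+ 2 <=
      #|nonadj ng B A|%:R * \sum_(u in A) f u ^+ 2.
  move=> nbr; rewrite nonadj_sum natr_sum mulr_suml; apply: ler_sum => w wB.
  have -> : codeg ng A w = #|[pred u | adj G u w]|.
    apply: eq_card => u; rewrite !inE negbK adj_sym andb_idl //.
    by apply: nbr; rewrite wB.
  rewrite -exprMn; apply: (@le_trans _ _ ((\sum_(u | adj G u w) f u) ^+ 2)).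
    by apply: lerXn2r (zf w); rewrite ?nnegrE ?mulr_ge0 ?sumr_ge0 ?normr_ge0.
  apply: le_trans (sqr_sum_le_card _ f_ge0) _.
  apply: ler_wpM2l; first exact: ler0n.
  rewrite [leRHS](bigID (fun u => adj G u w)) /= (eq_bigl (fun u => (u \in A) && adj G u w)).
    by rewrite lerDl sumr_ge0.
  by move=> u /=; rewrite andb_idl // => /(nbr _ _ wB).
have eqE : #|nonadj ng Y X| = #|nonadj ng X Y|.
  by apply: nonadj_swap => u w; rewrite /ng adj_sym.
have S_split F : \sum_u F u = \sum_(u in X) F u + \sum_(u in Y) F u :> algC.
  rewrite -bigU //; apply: eq_bigl => u; have := in_setT u.
  by rewrite -cXY !inE => ->.
have S_gt0 : 0 < \sum_u f u ^+ 2.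
  rewrite lt_neqAle sumr_ge0 // andbT eq_sym; apply: contraNneq v_neq0 => S0.
  apply/eqP/rowP => i; rewrite mxE.
  have /psumr_eq0P : \sum_u f u ^+ 2 = 0 := S0.
  move=> /(_ (fun u _ => f2_ge0 u) (enum_val i) isT)/eqP.
  by rewrite expf_eq0 /= normr_eq0 enum_valK => /eqP.
rewrite -(ler_pM2r S_gt0) mulr_sumr S_split [in leRHS]S_split mulrDr [leLHS]addrC.
apply: lerD.
  rewrite -eqE; apply: half => u w wY /bip/orP[/andP[]//|/andP[_ wX]].
  by rewrite (disjointFr dXY wX) in wY.
apply: half => u w wX /bip/orP[/andP[_ wY]|/andP[]//].
by rewrite (disjointFr dXY wX) in wY.
Qed.

Lemma rho_ge0 (V : finType) (G : sgraph V) : 0 <= rho G.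
Proof.
rewrite /rho; have [->|[z _ ->]] := spectral_radius_attained (adjacency G) => //.
Qed.

Lemma rho_sqr_le (V : finType) (G : sgraph V) (X Y : {set V}) :
  is_bipartition G X Y ->
  rho G ^+ 2 <= #|nonadj (fun u v => ~~ adj G u v) X Y|%:R.
Proof.
rewrite /rho => bip.
have [->|[z zA ->]] := spectral_radius_attained (adjacency G).
  by rewrite expr0n ler0n.
exact: eigenvalue_sqr_le.
Qed.

(* For [n = k + 1] this is the characteristic equation, in the square of the
   eigenvalue, of the equitable partition of [extremal n] into its four parts. *)
Lemma extremal_quadratic_root (k : nat) : (0 < k)%N ->
  exists lam : algC, [/\ 0 <= lam, (k * k.+1)%:R < lam &
    lam ^+ 2 = (k * k.+1).+1%:R * lam - k%:R ^+ 2].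
Proof.
move=> k_gt0; pose b : algC := (k * k.+1).+1%:R.
have bE : b = k%:R ^+ 2 + k%:R + 1 by rewrite /b -natr1 natrM -natr1; ring.
have N_gt0 : (0 < k * k.+1)%N by rewrite muln_gt0 k_gt0.
(* The larger root (b + s)/2 exceeds b - 1 = k(k+1) as soon as s > b - 2, and the discriminant
   exceeds (b - 2)^2 by 4k. *)
pose s := sqrtC (b ^+ 2 - 4 * k%:R ^+ 2).
have lt_s : (k * k.+1).-1%:R < s.
  have natE : (k * k.+1).-1%:R = b - 2 :> algC.
    rewrite /b; case: (k * k.+1)%N N_gt0 => // N _.
    by rewrite -[in RHS]natr1 -[in RHS]natr1 /=; ring.
  have lt_sq : (k * k.+1).-1%:R ^+ 2 < b ^+ 2 - 4 * k%:R ^+ 2.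
    rewrite natE -subr_gt0.
    have -> : b ^+ 2 - 4 * k%:R ^+ 2 - (b - 2) ^+ 2 = 4 * k%:R by rewrite bE; ring.
    by rewrite mulr_gt0 ?ltr0n.
  have D_ge0 : 0 <= b ^+ 2 - 4 * k%:R ^+ 2.
    by apply: le_trans (ltW lt_sq); rewrite exprn_ge0 // ler0n.
  by rewrite -(ltr_pXn2r (n := 2)) ?nnegrE ?ler0n ?sqrtC_ge0 // sqrtCK.
have lt_lam : (k * k.+1)%:R < (b + s) / 2.
  rewrite ltr_pdivlMr ?ltr0n //.
  have -> : (k * k.+1)%:R * 2 = b + (k * k.+1).-1%:R :> algC.
    rewrite /b; case: (k * k.+1)%N N_gt0 => // N _.
    by rewrite -[N.+2%:R]natr1 -[N.+1%:R]natr1 /=; ring.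
  by rewrite ltrD2l.
exists ((b + s) / 2); split=> //.
  by apply: le_trans (ltW lt_lam); rewrite ler0n.
have s2 : s ^+ 2 = b ^+ 2 - 4 * k%:R ^+ 2 by rewrite sqrtCK.
by rewrite -/b expr_div_n sqrrD s2; field.
Qed.

(** The root [lam] is the square of an eigenvalue whose eigenvector is constant on the four
    parts. *)
Lemma rho_extremal_gt m : (m.+1 * m.+2)%:R < rho (extremal m.+2) ^+ 2.
Proof.
have [lam [lam_ge0 lt_lam lamE]] := extremal_quadratic_root (ltn0Sn m).
set k := m.+1 in lt_lam lamE *.
pose mu := sqrtC lam; have mu2 : mu ^+ 2 = lam by rewrite sqrtCK.
have lam_gt0 : 0 < lam by apply: le_lt_trans lt_lam; rewrite ler0n.
have mu_ge0 : 0 <= mu by rewrite sqrtC_ge0.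
apply: (lt_le_trans lt_lam); rewrite -{1}mu2.
suff ev : eigenvalue (adjacency (extremal m.+2)) mu.
  apply: lerXn2r; rewrite ?nnegrE ?rho_ge0 //.
  by rewrite -[leLHS](ger0_norm mu_ge0) eigenvalue_le_spectral_radius.
(* Solved outwards from the value [k%:R * mu] at the star centre. Given [mu ^+ 2 = lam], the
   equations at three parts are identities, and the one at [inl (inr _)] is the quadratic [lamE]. *)
pose g (w : ('I_1 + 'I_k) + ('I_k + 'I_1)) : algC := match w with
  | inl (inl _) => k%:R * lam
  | inl (inr _) => (lam - 1) * mu
  | inr (inl _) => k%:R * (lam - 1)
  | inr (inr _) => k%:R * mu
  end.
apply/eigenvalueP; exists (\row_i g (enum_val i)); last first.
  apply/eqP => /rowP/(_ (enum_rank (inl (inl ord0)))).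
  rewrite !mxE enum_rankK /= => /eqP.
  by rewrite mulf_eq0 pnatr_eq0 /= (gt_eqF lam_gt0).
apply/rowP => i; rewrite -[i]enum_valK adjacency_mul [RHS]mxE !mxE !enum_rankK.
under eq_bigr do rewrite mxE enum_rankK.
move: (enum_val i) => w; rewrite (eq_bigl _ _ (fun u => adj_extremal u w)).
rewrite big_mkcond !big_sumType.
case: w => -[j|j] /=; rewrite !sumr_const !card_ord ?mul0rn ?addr0 ?add0r ?mulr1n.
- by rewrite -[_ *+ m.+1]mulr_natl -/k; ring.
- rewrite -[_ *+ m.+1]mulr_natl -/k.
  have -> : mu * ((lam - 1) * mu) = lam ^+ 2 - lam by rewrite -mu2; ring.
  by rewrite lamE -natr1 natrM -natr1; ring.
- by rewrite -[_ *+ m.+1]mulr_natl -/k; ring.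
- by rewrite -mu2; ring.
Qed.

Lemma card_nonadj_of_rho (V : finType) (G : sgraph V) (X Y : {set V}) m :
  is_bipartition G X Y -> #|X| = m.+2 -> #|Y| = m.+2 ->
  rho (extremal m.+2) <= rho G -> (#|nonadj (adj G) X Y| <= m.+1)%N.
Proof.
move=> bip cX cY le_rho; have := nonadj_compl (adj G) X Y; rewrite cX cY.
(* More than [m.+1 * m.+2] of the [m.+2 * m.+2] pairs are edges, so fewer than [m.+2] are
   missing. *)
suff : (m.+1 * m.+2 < #|nonadj (fun u v => ~~ adj G u v) X Y|)%N by nia.
rewrite -(ltr_nat algC); apply: lt_le_trans (rho_extremal_gt m) _.
apply: le_trans (rho_sqr_le bip).
by apply: lerXn2r; rewrite ?nnegrE ?rho_ge0.
Qed.

Theorem theorem1p6 (n : nat) (X Y : {set 'I_(2 * n)})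
    (G : 'I_(2 * n) -> bigraph 'I_(2 * n)) :
  (2 <= n)%N ->
  (forall i, lpart (G i) = X /\ rpart (G i) = Y) ->
  (forall i, balanced (G i)) ->
  (forall i, rho (extremal n) <= rho (G i)) ->
  ~ ((forall i j, same_graph (G i) (G j)) /\
     (forall i, isomorphic (G i) (extremal n))) ->
  has_rainbow_hamilton_cycle (fun i => graph_of (G i)).
Proof.
case: n X Y G => [|[|m]] // X Y G _ parts bal le_rho not_ext.
have bip i : is_bipartition (G i) X Y.
  by case: (parts i) => <- <-; apply: bigraphP.
have i0 : 'I_(2 * m.+2) := ord0.
have eqXY : #|X| = #|Y| by case: (parts i0) (bal i0) => <- <-.
have [dXY cXY _] := bip i0.
have cX : #|X| = m.+2.
  have := cardsU X Y; rewrite cXY cardsT card_ord -eqXY.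
  by move: dXY; rewrite -setI_eq0 => /eqP->; rewrite cards0; lia.
have cY : #|Y| = m.+2 by rewrite -eqXY.
apply: (rainbow_hamilton_cycle cX cY bip) => // i.
exact: card_nonadj_of_rho.
Qed.
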